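(* The characteristic speeds and corresponding characteristic vector fields of the system $$p_t-\frac{\eta_T}{v_p\eta_T-v_T\eta_p}u_\xi=0,\qquad u_t+p_\xi=0,\qquad T_t+\frac{\eta_p}{v_p\eta_T-v_T\eta_p}u_\xi=0$$ in the state variables $(p,u,T)$ are $$\lambda_\pm=\pm\sqrt{-\frac{\eta_T}{v_p\eta_T-v_T\eta_p}},\quad \lambda_0=0,\qquad \boldsymbol r_\pm=\begin{bmatrix}\pm1\\ \left(-\frac{\eta_T}{v_p\eta_T-v_T\eta_p}\right)^{-1/2}\\ \mp\frac{\eta_p}{\eta_T}\end{bmatrix},\quad \boldsymbol r_0=\begin{bmatrix}0\\0\\1\end{bmatrix}.$$ The eigenvalue $\lambda_0$ is linearly degenerate, and a pair of Riemann invariants for $\lambda_0$ is $\{u,p\}$. A Riemann invariant for both $\lambda_+$ and $\lambda_-$ is $\eta$. The characteristic speeds of the Eulerian system $$\rho_t+(\rho u)_x=0,\quad (\rho u)_t+(\rho u^2+p)_x=0,\quad (\rho\mathcal E)_t+(\rho\mathcal E u+pu)_x=0$$ are then $u+\frac1\rho\lambda_\pm$ and $u$.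
   Context: Fixed constants: $R,M,\mu_A,\mu_B>0$, $0<\beta<1$, $0<T_A<T_B\le 2T_A$. For $p>0$, $T>0$ the degrees of ionization $\alpha_A,\alpha_B\in(0,1)$ are determined by $$p=\frac{(1-\alpha_A)(1+\alpha)}{\mu_A\alpha_A\alpha}T^{5/2}e^{-T_A/T}=\frac{(1-\alpha_B)(1+\alpha)}{\mu_B\alpha_B\alpha}T^{5/2}e^{-T_B/T},\qquad \alpha=\beta\alpha_A+(1-\beta)\alpha_B .$$ Specific volume: $v=1/\rho=\frac{RT}{Mp}(1+\alpha)$; specific enthalpy: $h=\frac{5RT}{2M}(1+\alpha)+\frac RM[\beta T_A\alpha_A+(1-\beta)T_B\alpha_B]$; internal energy $e=h-pv$; total energy $\mathcal E=\frac12u^2+e$; the specific entropy $S(p,T)$ satisfies $dh=T\,dS+v\,dp$, and $\eta=\frac MR S$. Subscripts $p,T$ on $v,\eta$ are partial derivatives in the independent variables $(p,T)$; $u$ is the flow velocity. The first system is the Lagrangian form $v_t-u_\xi=0$, $u_t+p_\xi=0$, $(e+\frac12u^2)_t+(pu)_\xi=0$ of the gas dynamics equations (for $C^1$ solutions, with the last equation equivalent to $\eta_t=0$) written in $(p,u,T)$. A Riemann invariant for an eigenvalue with eigenvector field $\boldsymbol r$ is a function $w$ with $\boldsymbol r\cdot\nabla w=0$; an eigenvalue $\lambda$ is linearly degenerate if $\boldsymbol r\cdot\nabla\lambda=0$ identically. *)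

(* Defs.v *)
From HB Require Import structures.
From mathcomp Require Import all_boot all_order all_algebra.
From mathcomp Require Import all_classical all_reals all_analysis.

Set Implicit Arguments.
Unset Strict Implicit.
Unset Printing Implicit Defensive.

Import Order.TTheory GRing.Theory Num.Theory.
Import numFieldNormedType.Exports.

Local Open Scope classical_set_scope.
Local Open Scope ring_scope.

Definition col3 (R : realType) (a b c : R) : 'cV[R]_3 :=
  \col_i [:: a; b; c]`_i.

Definition mx3 (R : realType) (rows : seq (seq R)) : 'M[R]_3 :=
  \matrix_(i, j) (nth [::] rows i)`_j.

Definition grad (R : realType) (f : 'cV[R]_3 -> R) (U : 'cV[R]_3) : 'rV[R]_3 :=
  \row_j 'D_(delta_mx j 0) f U.

(* Row i is the gradient of the i-th component; the library's ['J] acts on row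
   vectors and is the transpose of this matrix. *)
Definition jac (R : realType) (F : 'cV[R]_3 -> 'cV[R]_3) (U : 'cV[R]_3) :
    'M[R]_3 :=
  \matrix_(i, j) 'D_(delta_mx j 0) (fun V => F V i 0) U.

(* For the system [A0(U) U_t + A1(U) U_x = 0], with both matrices evaluated at
   the same state: [lam] and [r] solve [(A1 - lam A0) r = 0], [r <> 0].
   The system [U_t + A(U) U_x = 0] is the case [A0 = 1], and the conservation
   law [G(U)_t + F(U)_x = 0] is the case [A0 = jac G U], [A1 = jac F U]. *)
Definition char_vector (R : realType) (A0 A1 : 'M[R]_3) (lam : R)
    (r : 'cV[R]_3) : Prop :=
  r != 0 /\ A1 *m r = lam *: (A0 *m r).

Definition char_speed (R : realType) (A0 A1 : 'M[R]_3) (lam : R) : Prop :=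
  exists r : 'cV[R]_3, char_vector A0 A1 lam r.

Definition grad_annihilated (R : realType) (D : set 'cV[R]_3)
    (r : 'cV[R]_3 -> 'cV[R]_3) (f : 'cV[R]_3 -> R) : Prop :=
  forall U, D U -> differentiable f U /\ grad f U *m r U = 0.

Definition riemann_invariant (R : realType) (D : set 'cV[R]_3)
    (r : 'cV[R]_3 -> 'cV[R]_3) (w : 'cV[R]_3 -> R) : Prop :=
  grad_annihilated D r w.

Definition linearly_degenerate (R : realType) (D : set 'cV[R]_3)
    (r : 'cV[R]_3 -> 'cV[R]_3) (lam : 'cV[R]_3 -> R) : Prop :=
  grad_annihilated D r lam.

Record gas (R : realType) := Gas {
  Rg : R;  (* the constant usually written R *)
  Mm : R;  (* the constant usually written M *)
  muA : R; muB : R;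
  beta : R;
  TA : R; TB : R }.

(* Functions of the thermodynamic state take the pressure first, then the
   temperature. *)
Definition d_p (R : realType) (f : R -> R -> R) (p T : R) : R :=
  derive1 (fun q => f q T) p.

Definition d_T (R : realType) (f : R -> R -> R) (p T : R) : R :=
  derive1 (f p) T.

Definition alpha (R : realType) (g : gas R) (aA aB : R -> R -> R) (p T : R) : R :=
  beta g * aA p T + (1 - beta g) * aB p T.

Definition saha_pressure (R : realType) (mu Ti a al T : R) : R :=
  (1 - a) * (1 + al) / (mu * a * al) * (T `^ (5 / 2)) * expR (- (Ti / T)).

Definition ionization_degrees (R : realType) (g : gas R)
    (aA aB : R -> R -> R) : Prop :=
  forall p T : R, 0 < p -> 0 < T ->
    [/\ 0 < aA p T < 1, 0 < aB p T < 1,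
        p = saha_pressure (muA g) (TA g) (aA p T) (alpha g aA aB p T) T &
        p = saha_pressure (muB g) (TB g) (aB p T) (alpha g aA aB p T) T].

Definition volume (R : realType) (g : gas R) (aA aB : R -> R -> R) (p T : R) : R :=
  Rg g * T / (Mm g * p) * (1 + alpha g aA aB p T).

Definition density (R : realType) (g : gas R) (aA aB : R -> R -> R) (p T : R) : R :=
  (volume g aA aB p T)^-1.

Definition enthalpy (R : realType) (g : gas R) (aA aB : R -> R -> R) (p T : R) : R :=
  5 * Rg g * T / (2 * Mm g) * (1 + alpha g aA aB p T)
  + Rg g / Mm g
    * (beta g * TA g * aA p T + (1 - beta g) * TB g * aB p T).

Definition internal_energy (R : realType) (g : gas R) (aA aB : R -> R -> R)
    (p T : R) : R :=
  enthalpy g aA aB p T - p * volume g aA aB p T.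

(* [dh = T dS + v dp], as an identity of differentials at (p, T) applied to an
   arbitrary increment [w = (dp, dT)]. *)
Definition entropy (R : realType) (g : gas R) (aA aB : R -> R -> R)
    (S : R -> R -> R) : Prop :=
  forall p T : R, 0 < p -> 0 < T ->
    differentiable (fun x : R * R => S x.1 x.2) ((p, T) : R * R) /\
    forall w : R * R,
      'd (fun x : R * R => enthalpy g aA aB x.1 x.2) ((p, T) : R * R) w
      = T * 'd (fun x : R * R => S x.1 x.2) ((p, T) : R * R) w
        + volume g aA aB p T * w.1.

Definition eta_entropy (R : realType) (g : gas R) (S : R -> R -> R) (p T : R) : R :=
  Mm g / Rg g * S p T.

Definition prs (R : realType) (U : 'cV[R]_3) : R := U 0 0.
Definition vel (R : realType) (U : 'cV[R]_3) : R := U 1 0.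
Definition tmp (R : realType) (U : 'cV[R]_3) : R := U 2 0.

Definition states (R : realType) : set 'cV[R]_3 :=
  [set U | 0 < prs U /\ 0 < tmp U].

Definition at_state (R : realType) (f : R -> R -> R) (U : 'cV[R]_3) : R :=
  f (prs U) (tmp U).

(* [v_p eta_T - v_T eta_p] for given functions [v] and [e] of (p, T). *)
Definition jacobian_pT (R : realType) (v e : R -> R -> R) (p T : R) : R :=
  d_p v p T * d_T e p T - d_T v p T * d_p e p T.

Definition speed_sq (R : realType) (v e : R -> R -> R) (p T : R) : R :=
  - (d_T e p T / jacobian_pT v e p T).

(* The matrix A(U) of the system written as U_t + A(U) U_xi = 0. *)
Definition lagrange_mx (R : realType) (v e : R -> R -> R) (U : 'cV[R]_3) :
    'M[R]_3 :=
  let J := at_state (jacobian_pT v e) U in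
  mx3 [:: [:: 0; - (at_state (d_T e) U / J); 0];
          [:: 1; 0;                           0];
          [:: 0; at_state (d_p e) U / J;      0]].

Definition lam_plus (R : realType) (v e : R -> R -> R) (U : 'cV[R]_3) : R :=
  Num.sqrt (at_state (speed_sq v e) U).

Definition lam_minus (R : realType) (v e : R -> R -> R) (U : 'cV[R]_3) : R :=
  - Num.sqrt (at_state (speed_sq v e) U).

Definition lam_zero (R : realType) (U : 'cV[R]_3) : R := 0.

Definition r_plus (R : realType) (v e : R -> R -> R) (U : 'cV[R]_3) : 'cV[R]_3 :=
  col3 1 (Num.sqrt (at_state (speed_sq v e) U))^-1
       (- (at_state (d_p e) U / at_state (d_T e) U)).

Definition r_minus (R : realType) (v e : R -> R -> R) (U : 'cV[R]_3) : 'cV[R]_3 :=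
  col3 (- 1) (Num.sqrt (at_state (speed_sq v e) U))^-1
       (at_state (d_p e) U / at_state (d_T e) U).

Definition r_zero (R : realType) (U : 'cV[R]_3) : 'cV[R]_3 := col3 0 0 1.

Definition total_energy (R : realType) (g : gas R) (aA aB : R -> R -> R)
    (U : 'cV[R]_3) : R :=
  vel U ^+ 2 / 2 + at_state (internal_energy g aA aB) U.

(* The Eulerian system is [euler_cons(U)_t + euler_flux(U)_x = 0]. *)
Definition euler_cons (R : realType) (g : gas R) (aA aB : R -> R -> R)
    (U : 'cV[R]_3) : 'cV[R]_3 :=
  let rho := at_state (density g aA aB) U in
  let E := total_energy g aA aB U in
  col3 rho (rho * vel U) (rho * E).

Definition euler_flux (R : realType) (g : gas R) (aA aB : R -> R -> R)
    (U : 'cV[R]_3) : 'cV[R]_3 :=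
  let rho := at_state (density g aA aB) U in
  let E := total_energy g aA aB U in
  col3 (rho * vel U) (rho * vel U ^+ 2 + prs U)
       (rho * E * vel U + prs U * vel U).

(* Main.v *)
(** Everything reduces to four facts at a state (p, T): the volume and the
    enthalpy are differentiable, h_p = v - T v_T, h_T > 0, and
    v_p h_T / T + v_T^2 < 0. The formula for h_p makes S_p = - v_T and S_T = h_T / T, so
    the last two give eta_T > 0 and v_p eta_T - v_T eta_p < 0.

    With c_i = mu_i p T^(-5/2) exp(T_i / T), Saha's equations read
    alpha_i = 1 / (1 + c_i alpha / (1 + alpha)). The resulting increment
    identity alpha - alpha0 = sum_i g_i (c_i - c_i0) has bounded g_i, which
    gives first the continuity of alpha, then that of the g_i, then
    differentiability (Caratheodory), without an implicit function theorem.

    With w_i = beta_i alpha_i (1 - alpha_i), k_i = 5/2 + T_i / T, W = sum w_i,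
    N = sum w_i k_i, Q = sum w_i k_i^2 and D = 1 + W / (alpha (1 + alpha)), the
    derivatives of v and h are explicit, and the two inequalities follow from
    N^2 <= W Q and 2 k <= k^2 + 1. *)

Require Import Defs.
From HB Require Import structures.
From mathcomp Require Import all_boot all_order all_algebra.
From mathcomp Require Import all_classical all_reals all_analysis.
From mathcomp Require Import ring.

Set Implicit Arguments.
Unset Strict Implicit.
Unset Printing Implicit Defensive.

Import Order.TTheory GRing.Theory Num.Theory.
Import numFieldNormedType.Exports.

Local Open Scope classical_set_scope.
Local Open Scope ring_scope.

(** * Differentiability from continuous difference quotients *)

(** The bound is a first-order expansion with zero linear part, and [diff_unique] identifies the
    differential with that part. *)
Lemma is_diff_littleo (R : realType) (V : normedModType R) (r : V -> R) (x : V) :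
  r x = 0 ->
  (forall e, 0 < e -> \forall h \near (0 : V), `|r (h + x)| <= e * `|h|) ->
  is_diff x r 0.
Proof.
move=> rx0 ro.
have E : r \o shift x = cst (r x) + (0 : V -> R) +o_ 0 id.
  apply/eqaddoP => e e0; near=> h.
  have := near (ro e e0) h; rewrite rx0 => H.
  have -> : (r \o shift x - (cst 0 + (0 : V -> R))) h = r (h + x).
    by rewrite !fctE /= addr0 subr0.
  by apply: H.
have H : continuous (\0 : V -> R) by move=> ?; exact: cvg_cst.
have dr : 'd r x = \0 :> (V -> R) by apply: (diff_unique H).
split=> //; apply/diff_locallyP; rewrite dr; split=> //.
Unshelve. all: by end_near. Qed.

Lemma is_diff_near (R : realType) (V : normedModType R) (f g df : V -> R)
    (x : V) :
  (\forall y \near x, f y = g y) -> is_diff x f df -> is_diff x g df.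
Proof.
move=> fg hf; have fgx : f x = g x := nbhs_singleton fg.
have h0 : is_diff x (g - f) 0.
  apply: is_diff_littleo; first by rewrite !fctE fgx subrr.
  move=> e e0; move: fg; rewrite (near_shift 0); apply: filterS => h /=.
  rewrite subr0 => fgh.
  by rewrite !fctE fgh subrr normr0 mulr_ge0 // ltW.
have -> : g = f + (g - f) by apply/funext => y; rewrite !fctE addrC subrK.
by have := is_diffD hf h0; rewrite addr0.
Qed.

(** Caratheodory's product rule: [g] need only be continuous, since replacing [g y] by [g x] costs
    an o(1) factor times [c y - c x], which is O(h). *)
Lemma is_diff_mul_center (R : realType) (V : normedModType R)
    (g c dc : V -> R) (x : V) :
  {for x, continuous g} -> is_diff x c dc ->
  is_diff x (fun y => g y * (c y - c x)) (fun w => g x * dc w).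
Proof.
move=> cg hc.
have h0 : is_diff x (fun y => (g y - g x) * (c y - c x)) 0.
  apply: is_diff_littleo; first by rewrite !subrr mul0r.
  move=> e e0.
  (* [k] is a Lipschitz constant of the differential of [c], plus one for the remainder, whose o(h)
     bound is taken with coefficient 1. *)
  have [k k0 hk] : exists2 k, 0 < k &
      \forall h \near (0 : V), `|c (h + x) - c x| <= k * `|h|.
    have cx : differentiable c x by case: hc.
    have [cdc /eqaddoP cE] := (diff_locallyP x c).1 cx.
    have [k k0 lip] := linear_lipschitz cdc.
    exists (k + 1); first exact: addr_gt0.
    have := cE _ ltr01; apply: filterS => h; rewrite !fctE /= mul1r => hh.
    have -> : c (h + x) - c x =
        (c (h + x) - (c x + 'd c x h)) + 'd c x h by ring.
    rewrite mulrDl mul1r addrC.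
    by apply: (le_trans (ler_normD _ _)); apply: lerD.
  have gk : \forall h \near (0 : V), `|g (h + x) - g x| <= e / k.
    have : \forall y \near x, `|g x - g y| <= e / k.
      by move/cvgrPdist_le : cg; apply; exact: divr_gt0.
    rewrite (near_shift 0); apply: filterS => h /=.
    by rewrite subr0 distrC.
  apply: filterS2 hk gk => h hkh gkh.
  rewrite normrM -[e](divfK (lt0r_neq0 k0)) -(mulrA (e / k)).
  exact: ler_pM.
have := is_diffD (is_diffZ (g x) (is_diffB hc (is_diff_cst (c x) x))) h0.
congr (is_diff_def _ _ _); apply/funext => y; rewrite !fctE /GRing.scale/=.
  ring.
by change (g x * (dc y - 0) + 0 = g x * dc y); rewrite subr0 addr0.
Qed.

(** * Degrees of ionization *)

(* [D >= 1], so the increments of [A] are controlled by those of [c1] and [c2]. *)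
Lemma mean_degree_increment (R : realType) (b1 b2 A A0 c1 c2 k1 k2 : R) :
  let z := A / (1 + A) in let z0 := A0 / (1 + A0) in
  let a1 := (1 + c1 * z)^-1 in let a2 := (1 + c2 * z)^-1 in
  let e1 := (1 + k1 * z0)^-1 in let e2 := (1 + k2 * z0)^-1 in
  let D := 1 + (b1 * a1 * e1 * k1 + b2 * a2 * e2 * k2) / ((1 + A) * (1 + A0)) in
  0 < A -> 0 < A0 -> 0 < c1 -> 0 < c2 -> 0 < k1 -> 0 < k2 ->
  0 < b1 -> 0 < b2 ->
  A = b1 * a1 + b2 * a2 -> A0 = b1 * e1 + b2 * e2 ->
  A - A0 = - (b1 * a1 * e1 * z / D) * (c1 - k1)
           - b2 * a2 * e2 * z / D * (c2 - k2).
Proof.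
move=> z z0 a1 a2 e1 e2 D A_gt0 A0_gt0 c1_gt0 c2_gt0 k1_gt0 k2_gt0 b1_gt0 b2_gt0.
move=> AE A0E.
have z_gt0 : 0 < z by rewrite divr_gt0 ?addr_gt0.
have z0_gt0 : 0 < z0 by rewrite divr_gt0 ?addr_gt0.
have inv_gt0 (c y : R) : 0 < c -> 0 < y -> 0 < (1 + c * y)^-1.
  by move=> ? ?; rewrite invr_gt0 addr_gt0 ?mulr_gt0.
have D_gt0 : 0 < D.
  by do ![apply: addr_gt0 => //|apply: divr_gt0 => //|apply: mulr_gt0 => //
         |apply: inv_gt0 => //].
(* Subtracting the reciprocals leaves [c * z - k * z0], split as [k * (z - z0) + z * (c - k)]; the
   first part is proportional to [A - A0]. *)
have inc (c k : R) : 0 < c -> 0 < k -> (1 + c * z)^-1 - (1 + k * z0)^-1 =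
    - ((1 + c * z)^-1 * (1 + k * z0)^-1
       * (k * ((A - A0) / ((1 + A) * (1 + A0))) + z * (c - k))).
  move=> c_gt0 k_gt0.
  have -> : (A - A0) / ((1 + A) * (1 + A0)) = z - z0.
    by rewrite /z /z0; field; rewrite !lt0r_neq0 ?addr_gt0.
  have cz := addr_gt0 ltr01 (mulr_gt0 c_gt0 z_gt0).
  have kz := addr_gt0 ltr01 (mulr_gt0 k_gt0 z0_gt0).
  field.
  by rewrite !lt0r_neq0.
(* [D] collects the [A - A0] terms that [inc] creates on the right, once they are moved to the
   left. *)
apply: (@mulfI _ D); first exact: lt0r_neq0.
transitivity (- (b1 * a1 * e1 * z) * (c1 - k1) - b2 * a2 * e2 * z * (c2 - k2));
  last by field; exact: lt0r_neq0.
have := inc c1 k1 c1_gt0 k1_gt0; have := inc c2 k2 c2_gt0 k2_gt0.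
rewrite -/a1 -/a2 -/e1 -/e2 => i2 i1.
have : A - A0 = b1 * (a1 - e1) + b2 * (a2 - e2) by rewrite [in LHS]AE [in LHS]A0E; ring.
rewrite i1 i2 => dA.
rewrite /D mulrDl mul1r [in X in X + _]dA; ring.
Qed.

Lemma is_diff_mean_degree (R : realType) (V : normedModType R) (b1 b2 : R)
    (c1 c2 dc1 dc2 a1 a2 : V -> R) (x : V) :
  let A y := b1 * a1 y + b2 * a2 y in
  let z y := A y / (1 + A y) in
  let D := 1 + (b1 * a1 x * a1 x * c1 x + b2 * a2 x * a2 x * c2 x)
               / ((1 + A x) * (1 + A x)) in
  0 < b1 -> 0 < b2 ->
  (\forall y \near x, [/\ 0 < c1 y, 0 < c2 y, 0 < A y,
     a1 y = (1 + c1 y * z y)^-1 & a2 y = (1 + c2 y * z y)^-1]) ->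
  is_diff x c1 dc1 -> is_diff x c2 dc2 ->
  is_diff x A (fun w => - (b1 * a1 x * a1 x * z x / D) * dc1 w
                        - b2 * a2 x * a2 x * z x / D * dc2 w).
Proof.
move=> A z D b1_gt0 b2_gt0 sol dfc1 dfc2.
(* [Dn y] is the denominator of the increment identity between [y] and [x]; [D] is its value at
   [y = x]. *)
pose Dn y := 1 + (b1 * a1 y * a1 x * c1 x + b2 * a2 y * a2 x * c2 x)
                 / ((1 + A y) * (1 + A x)).
have [c1x c2x Ax a1x a2x] := nbhs_singleton sol.
have inv_in (c y : R) : 0 < c -> 0 < y -> 0 < (1 + c * y)^-1 <= 1.
  move=> c0 y0; have cy : 1 <= 1 + c * y by rewrite lerDl ltW ?mulr_gt0.
  by rewrite invr_gt0 (lt_le_trans ltr01 cy) invf_le1 ?(lt_le_trans ltr01 cy).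
have z_in y : 0 < A y -> 0 < z y <= 1.
  move=> Ay; have A1 : 0 < 1 + A y by rewrite addr_gt0.
  by rewrite divr_gt0//= ler_pdivrMr// mul1r lerDr.
have inc : \forall y \near x, A y - A x =
    - (b1 * a1 y * a1 x * z y / Dn y) * (c1 y - c1 x)
    - b2 * a2 y * a2 x * z y / Dn y * (c2 y - c2 x).
  apply: filterS sol => y [c1y c2y Ay a1y a2y].
  have := @mean_degree_increment R b1 b2 (A y) (A x) (c1 y) (c2 y) (c1 x) (c2 x)
            Ay Ax c1y c2y c1x c2x b1_gt0 b2_gt0.
  rewrite -/(z y) -/(z x) -a1x -a2x -a1y -a2y; exact.
(* Continuity of [A] is not yet available: the coefficients are bounded by [b1] and [b2] because the
   degrees and [z] lie in (0, 1] and [Dn] is at least 1. *)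
have bound : \forall y \near x,
    `|A y - A x| <= b1 * `|c1 y - c1 x| + b2 * `|c2 y - c2 x|.
  apply: filterS2 sol inc => y [c1y c2y Ay a1y a2y] ->.
  have /andP[z0 z1] := z_in _ Ay.
  have /andP[a10 a11] : 0 < a1 y <= 1 by rewrite a1y inv_in.
  have /andP[a20 a21] : 0 < a2 y <= 1 by rewrite a2y inv_in.
  have /andP[e10 e11] : 0 < a1 x <= 1.
    by rewrite a1x inv_in//; case/andP: (z_in _ Ax).
  have /andP[e20 e21] : 0 < a2 x <= 1.
    by rewrite a2x inv_in//; case/andP: (z_in _ Ax).
  have D1 : 1 <= Dn y.
    rewrite lerDl ltW//.
    by do ![apply: addr_gt0 => //|apply: divr_gt0 => //|apply: mulr_gt0 => //].
  have D0 := lt_le_trans ltr01 D1.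
  have coef (b a e : R) : 0 < b -> 0 < a <= 1 -> 0 < e <= 1 ->
      `|b * a * e * z y / Dn y| <= b.
    move=> b0 /andP[a0' a1'] /andP[e0' e1'].
    rewrite ger0_norm; last first.
      by rewrite ltW//; do ![apply: divr_gt0 => //|apply: mulr_gt0 => //].
    rewrite ler_pdivrMr// -!mulrA ler_pM2l// (le_trans _ D1)//.
    have [a0w e0w z0w] := And3 (ltW a0') (ltW e0') (ltW z0).
    by apply: mulr_ile1 => //; [exact: mulr_ge0|exact: mulr_ile1].
  apply: (le_trans (ler_normB _ _)); rewrite !normrM normrN -!normrM.
  by apply: lerD; rewrite normrM ler_wpM2r// coef ?a10 ?a20 ?e10 ?e20.
have cc1 : c1 @ x --> c1 x by apply: differentiable_continuous; case: dfc1.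
have cc2 : c2 @ x --> c2 x by apply: differentiable_continuous; case: dfc2.
have cA : A @ x --> A x.
  apply/cvgrPdist_le => e e0; have B := addr_gt0 b1_gt0 b2_gt0.
  have eB := divr_gt0 e0 B.
  move/cvgrPdist_le : cc1 => /(_ _ eB) h1.
  move/cvgrPdist_le : cc2 => /(_ _ eB) h2.
  apply: filterS3 bound h1 h2 => y H H1 H2.
  rewrite distrC (le_trans H)// -[e](divfK (lt0r_neq0 B)) mulrDr.
  by apply: lerD; rewrite mulrC ler_pM2r// distrC.
have A1x : 1 + A x != 0 by rewrite lt0r_neq0// addr_gt0.
have cA1 : 1 + A y @[y --> x] --> 1 + A x by apply: cvgD => //; exact: cvg_cst.
have cz : z @ x --> z x by apply: cvgM => //; exact: cvgV.
have cont_inv (c : V -> R) : 0 < c x -> c @ x --> c x ->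
    (1 + c y * z y)^-1 @[y --> x] --> (1 + c x * z x)^-1.
  move=> c0 cc; apply: cvgV.
    by rewrite lt0r_neq0// addr_gt0// mulr_gt0//; case/andP: (z_in _ Ax).
  by apply: cvgD; [exact: cvg_cst|exact: cvgM].
(* Near [x], [a1] equals the reciprocal just treated, so it inherits continuity from [c1] and
   [A]. *)
have ca1 : a1 @ x --> a1 x.
  rewrite [X in _ --> X]a1x; apply: cvg_trans (cont_inv _ c1x cc1).
  by apply: near_eq_cvg; apply: filterS sol => y [].
have ca2 : a2 @ x --> a2 x.
  rewrite [X in _ --> X]a2x; apply: cvg_trans (cont_inv _ c2x cc2).
  by apply: near_eq_cvg; apply: filterS sol => y [].
have D_gt0 : 0 < D.
  have /andP[z0 z1] := z_in _ Ax.
  have /andP[e10 e11] : 0 < a1 x <= 1 by rewrite a1x inv_in.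
  have /andP[e20 e21] : 0 < a2 x <= 1 by rewrite a2x inv_in.
  by do ![apply: addr_gt0 => //|apply: divr_gt0 => //|apply: mulr_gt0 => //].
have cD : Dn @ x --> D.
  apply: cvgD; first exact: cvg_cst.
  apply: cvgM.
    by apply: cvgD; do !apply: cvgM => //; exact: cvg_cst.
  apply: cvgV; first by rewrite mulf_neq0.
  by apply: cvgM => //; exact: cvg_cst.
have cG (b : R) (a : V -> R) : a @ x --> a x ->
    {for x, continuous (fun y => b * a y * a x * z y / Dn y)}.
  move=> ca; rewrite /continuous_at; apply: cvgM.
    by do !apply: cvgM => //; exact: cvg_cst.
  by apply: cvgV => //; exact: lt0r_neq0.
have d1 := is_diff_mul_center (cG b1 a1 ca1) dfc1.
have d2 := is_diff_mul_center (cG b2 a2 ca2) dfc2.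
have := is_diffD (is_diff_cst (A x) x) (is_diffN (is_diffD d1 d2)).
rewrite /= -/D => H.
apply: is_diff_near (is_diff_eq H _).
  apply: filterS inc => y; rewrite !fctE /cst /= => /(canRL (subrK _)) ->; ring.
by apply/funext => w; rewrite !fctE /= add0r; ring.
Qed.

(** This is c_i at the pair (p, T), with the power T^(-5/2) moved into the exponential so that one
    chain rule covers both factors. *)
Definition saha_coef (R : realType) (mu Ti : R) (x : R * R) : R :=
  mu * x.1 * expR (Ti / x.2 - 5 / 2 * ln x.2).

Lemma saha_coef_gt0 (R : realType) (mu Ti : R) (x : R * R) :
  0 < mu -> 0 < x.1 -> 0 < saha_coef mu Ti x.
Proof. by move=> mu0 x0; rewrite !mulr_gt0 ?expR_gt0. Qed.

(** Saha's equation says that c_i alpha / (1 + alpha) equals (1 - a) / a, and adding 1 gives 1 /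
    a. *)
Lemma saha_pressure_solved (R : realType) (mu Ti a al p T : R) :
  0 < mu -> 0 < T -> 0 < a -> 0 < al ->
  p = saha_pressure mu Ti a al T ->
  a = (1 + saha_coef mu Ti (p, T) * (al / (1 + al)))^-1.
Proof.
move=> mu0 T0 a0 al0 pE.
have al1 : 0 < 1 + al by rewrite addr_gt0.
have E0 := expR_gt0 (Ti / T - 5 / 2 * ln T).
have TE : T `^ (5 / 2) * expR (- (Ti / T)) = (expR (Ti / T - 5 / 2 * ln T))^-1.
  by rewrite /powR (gt_eqF T0) -expRD -expRN; congr expR; ring.
have -> : saha_coef mu Ti (p, T) * (al / (1 + al)) = (1 - a) / a.
  move: pE; rewrite /saha_pressure -mulrA TE => ->; rewrite /saha_coef /=; field.
  by rewrite !lt0r_neq0.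
have -> : 1 + (1 - a) / a = a^-1 by field; rewrite lt0r_neq0.
by rewrite invrK.
Qed.

Lemma is_diff_fst (R : realType) (x : R * R) :
  is_diff x (fun y : R * R => y.1) (fun w => w.1).
Proof.
have cf : continuous (fst : R * R -> R) by move=> y; exact: cvg_fst.
split; first exact: (@linear_differentiable _ _ _ fst).
exact: (@diff_lin _ _ _ fst).
Qed.

Lemma is_diff_snd (R : realType) (x : R * R) :
  is_diff x (fun y : R * R => y.2) (fun w => w.2).
Proof.
have cf : continuous (snd : R * R -> R) by move=> y; exact: cvg_snd.
split; first exact: (@linear_differentiable _ _ _ snd).
exact: (@diff_lin _ _ _ snd).
Qed.

Lemma is_derive_is_diff (R : realType) (f : R -> R) (x df : R) :
  is_derive x 1 f df -> is_diff x f (fun h => h * df).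
Proof.
move=> [fx fE]; have df1 := (derivable1_diffP f x).1 fx.
by split=> //; rewrite (diff1E df1) derive1E fE.
Qed.

(** The logarithmic differential of c_i is dp / p - k_i dT / T; the weights k_i originate here. *)
Lemma is_diff_saha_coef (R : realType) (mu Ti p T : R) :
  0 < p -> 0 < T ->
  is_diff ((p, T) : R * R) (saha_coef mu Ti)
    (fun w => saha_coef mu Ti (p, T) * (w.1 / p - (5 / 2 + Ti / T) * (w.2 / T))).
Proof.
move=> p0 T0; have TN : T != 0 by rewrite lt0r_neq0.
pose E := expR (Ti / T - 5 / 2 * ln T).
have dk : is_derive T 1 (fun t => expR (Ti / t - 5 / 2 * ln t))
            (- (E * ((5 / 2 + Ti / T) / T))).
  have dl := is_derive1_ln T0.
  have di := is_deriveV TN (is_derive_id T 1).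
  have dg := is_deriveB (is_deriveZ Ti di) (is_deriveZ (5 / 2) dl).
  have := is_derive1_comp (is_derive_expR _) dg.
  congr (is_derive _ _ _ _); rewrite /E !fctE /GRing.scale /=.
  by field.
have d2 := is_diff_comp (is_diff_snd (p, T)) (is_derive_is_diff dk).
have := is_diffM (is_diffZ mu (is_diff_fst (p, T))) d2.
congr (is_diff_def _ _ _); apply/funext => w.
rewrite /saha_coef !fctE /GRing.scale /= -/E.
by field; rewrite TN lt0r_neq0.
Qed.

Lemma is_diff_inv (R : realType) (V : normedModType R) (f df : V -> R)
    (x : V) :
  f x != 0 -> is_diff x f df ->
  is_diff x (fun y => (f y)^-1) (fun w => - ((f x)^-1 * (f x)^-1 * df w)).
Proof.
move=> fx hf.
have hi : is_diff (f x) (GRing.inv : R -> R) (fun h => - (f x) ^- 2 *: h).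
  by split; [exact: differentiable_Rinv|exact: diff_Rinv].
have := is_diff_comp hf hi.
congr (is_diff_def _ _ _); apply/funext => w /=.
by rewrite /GRing.scale /=; field.
Qed.

(** Once the mean degree [A] is differentiable, a single degree is an explicit function of [c] and
    [A]; 1 / (1 + A)^2 is the derivative of A / (1 + A). *)
Lemma is_diff_degree (R : realType) (V : normedModType R)
    (c dc A dA a : V -> R) (x : V) :
  0 < c x -> 0 < A x ->
  (\forall y \near x, a y = (1 + c y * (A y / (1 + A y)))^-1) ->
  is_diff x c dc -> is_diff x A dA ->
  is_diff x a (fun w => - (a x * a x) *
    (c x * (dA w / ((1 + A x) * (1 + A x))) + A x / (1 + A x) * dc w)).
Proof.
move=> cx Ax aE dfc dfA.
have A1x : 0 < 1 + A x by rewrite addr_gt0.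
have A1N := lt0r_neq0 A1x.
have d1 := @is_diff_inv _ _ (cst 1 + A) _ _ A1N (is_diffD (is_diff_cst (1 : R) x) dfA).
have dz := is_diffM dfA d1.
have cz : 0 < 1 + c x * (A x / (1 + A x)).
  by rewrite addr_gt0// mulr_gt0// divr_gt0.
have d2 := @is_diff_inv _ _
  (cst 1 + c * (A * (fun y => ((cst 1 + A) y)^-1))) _ _ (lt0r_neq0 cz)
  (is_diffD (is_diff_cst (1 : R) x) (is_diffM dfc dz)).
apply: is_diff_near (is_diff_eq d2 _).
  by apply: filterS aE => y ->.
apply/funext => w; rewrite (nbhs_singleton aE) !fctE /cst /GRing.scale /=.
rewrite !add0r.
by field; rewrite A1N/= lt0r_neq0// addr_gt0// mulr_gt0.
Qed.

Lemma near_pos_pair (R : realType) (p T : R) : 0 < p -> 0 < T ->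
  \forall x \near ((p, T) : R * R), 0 < x.1 /\ 0 < x.2.
Proof.
move=> p0 T0.
exists ([set t | 0 < t], [set t | 0 < t]); last by move=> [].
by split; [exact: lt_nbhsr p0|exact: lt_nbhsr T0].
Qed.

(** [di] is Saha's equation differentiated logarithmically: da / (a (1 - a)) = - dp / p - q d alpha
    + k dT / T. Averaging over the two species with weights beta and 1 - beta and solving for d
    alpha gives [da], with denominator [D]. *)
Lemma ionization_increments (R : realType) (g : gas R) (aA aB : R -> R -> R)
    (p T : R) :
  0 < muA g -> 0 < muB g -> 0 < beta g < 1 -> ionization_degrees g aA aB ->
  0 < p -> 0 < T ->
  let al := alpha g aA aB p T in
  let kA := 5 / 2 + TA g / T in let kB := 5 / 2 + TB g / T in
  let wA := beta g * (aA p T * (1 - aA p T)) in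
  let wB := (1 - beta g) * (aB p T * (1 - aB p T)) in
  let q := (al * (1 + al))^-1 in
  let D := 1 + q * (wA + wB) in
  let da (w : R * R) :=
    (- (wA + wB) * (w.1 / p) + (wA * kA + wB * kB) * (w.2 / T)) / D in
  let di a k (w : R * R) :=
    a * (1 - a) * (- (w.1 / p) - q * da w + k * (w.2 / T)) in
  [/\ is_diff ((p, T) : R * R) (fun x : R * R => alpha g aA aB x.1 x.2) da,
      is_diff ((p, T) : R * R) (fun x : R * R => aA x.1 x.2) (di (aA p T) kA) &
      is_diff ((p, T) : R * R) (fun x : R * R => aB x.1 x.2) (di (aB p T) kB)].
Proof.
move=> mA mB /andP[b0 b1] ion p0 T0 al kA kB wA wB q D da di.
have b1' : 0 < 1 - beta g by rewrite subr_gt0.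
have al_gt0 x : 0 < x.1 -> 0 < x.2 -> 0 < alpha g aA aB x.1 x.2.
  move=> x1 x2; have [/andP[? _] /andP[? _] _ _] := ion _ _ x1 x2.
  by rewrite addr_gt0// mulr_gt0.
have sol x : 0 < x.1 -> 0 < x.2 ->
    aA x.1 x.2 = (1 + saha_coef (muA g) (TA g) x
       * (alpha g aA aB x.1 x.2 / (1 + alpha g aA aB x.1 x.2)))^-1 /\
    aB x.1 x.2 = (1 + saha_coef (muB g) (TB g) x
       * (alpha g aA aB x.1 x.2 / (1 + alpha g aA aB x.1 x.2)))^-1.
  move=> x1 x2; have [/andP[? _] /andP[? _] hA hB] := ion _ _ x1 x2.
  by rewrite [x in saha_coef _ _ x]surjective_pairing; split;
    apply: saha_pressure_solved; rewrite ?al_gt0.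
have cA := is_diff_saha_coef (muA g) (TA g) p0 T0.
have cB := is_diff_saha_coef (muB g) (TB g) p0 T0.
have near0 := near_pos_pair p0 T0.
have al0 : 0 < al by exact: (al_gt0 (p, T)).
have [sA sB] := sol (p, T) p0 T0.
have cA0 : 0 < saha_coef (muA g) (TA g) (p, T) by exact: saha_coef_gt0.
have cB0 : 0 < saha_coef (muB g) (TB g) (p, T) by exact: saha_coef_gt0.
have [/andP[a0 a1] /andP[a0' a1'] _ _] := ion _ _ p0 T0.
have D0 : 0 < D.
  rewrite addr_gt0// mulr_gt0//.
    by rewrite invr_gt0 mulr_gt0// addr_gt0.
  by rewrite addr_gt0// !mulr_gt0// subr_gt0.
have al1 : 0 < 1 + al by rewrite addr_gt0.
(* Solving Saha's equation for the coefficient removes the exponentials from the derivatives in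
   favour of [a] and [al]. *)
have coefE c a : 0 < a -> a = (1 + c * (al / (1 + al)))^-1 ->
    c = (1 - a) / a * ((1 + al) / al).
  move=> a_gt0 /(congr1 GRing.inv); rewrite invrK => aE.
  apply: (@mulIf _ (al / (1 + al))); first by rewrite lt0r_neq0// divr_gt0.
  apply: (addrI 1); rewrite -aE; field.
  by rewrite !lt0r_neq0.
have cAE := coefE _ _ a0 sA; have cBE := coefE _ _ a0' sB.
have nsol : \forall y \near ((p, T) : R * R),
    [/\ 0 < saha_coef (muA g) (TA g) y, 0 < saha_coef (muB g) (TB g) y,
        0 < alpha g aA aB y.1 y.2,
        aA y.1 y.2 = (1 + saha_coef (muA g) (TA g) y
          * (alpha g aA aB y.1 y.2 / (1 + alpha g aA aB y.1 y.2)))^-1 &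
        aB y.1 y.2 = (1 + saha_coef (muB g) (TB g) y
          * (alpha g aA aB y.1 y.2 / (1 + alpha g aA aB y.1 y.2)))^-1].
  apply: filterS near0 => y [y1 y2]; have [? ?] := sol y y1 y2.
  by split; rewrite ?saha_coef_gt0 ?al_gt0.
have pN := lt0r_neq0 p0; have TN := lt0r_neq0 T0; have alN := lt0r_neq0 al0.
have al1N := lt0r_neq0 al1; have aN := lt0r_neq0 a0; have aN' := lt0r_neq0 a0'.
have DN : al * (1 + al) + (wA + wB) != 0.
  by rewrite lt0r_neq0// addr_gt0// ?mulr_gt0// addr_gt0// !mulr_gt0// subr_gt0.
have := @is_diff_mean_degree R (R * R)%type (beta g) (1 - beta g) _ _ _ _
  (fun x => aA x.1 x.2) (fun x => aB x.1 x.2) (p, T) b0 b1' nsol cA cB.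
rewrite /= -/(alpha g aA aB p T) -/al -/kA -/kB cAE cBE => dal.
(* After [cAE] and [cBE], a^2 c / (1 + al)^2 equals q a (1 - a), which turns the denominator of
   [is_diff_mean_degree] into [D]. *)
have {}dal : is_diff ((p, T) : R * R) (fun x : R * R => alpha g aA aB x.1 x.2) da.
  apply: is_diff_eq dal _; apply/funext => w.
  rewrite /da /D /q /wA /wB; field.
  rewrite al1N alN DN TN pN aN' aN /=.
  rewrite (_ : _ + _ = (1 + al) * (al * (1 + al) + (wA + wB))).
    by rewrite mulf_neq0.
  by rewrite /wA /wB; ring.
split => //.
  have sAn : \forall y \near ((p, T) : R * R), aA y.1 y.2 =
      (1 + saha_coef (muA g) (TA g) y
           * (alpha g aA aB y.1 y.2 / (1 + alpha g aA aB y.1 y.2)))^-1.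
    by apply: filterS nsol => y [].
  apply: is_diff_eq (@is_diff_degree R (R * R)%type _ _
    (fun y => alpha g aA aB y.1 y.2) da
    (fun y => aA y.1 y.2) (p, T) cA0 al0 sAn cA dal) _.
  apply/funext => w; rewrite /= -/al -/kA cAE /di /q; field.
  by rewrite al1N alN TN pN aN.
have sBn : \forall y \near ((p, T) : R * R), aB y.1 y.2 =
    (1 + saha_coef (muB g) (TB g) y
         * (alpha g aA aB y.1 y.2 / (1 + alpha g aA aB y.1 y.2)))^-1.
  by apply: filterS nsol => y [].
apply: is_diff_eq (@is_diff_degree R (R * R)%type _ _
    (fun y => alpha g aA aB y.1 y.2) da
  (fun y => aB y.1 y.2) (p, T) cB0 al0 sBn cB dal) _.
apply/funext => w; rewrite /= -/al -/kB cBE /di /q; field.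
by rewrite al1N alN TN pN aN'.
Qed.

(** * Volume, enthalpy and entropy *)

(** Here [s] stands for 1 + alpha. The first quantity is h_T up to the factor R / M, and the second
    inequality is v_p h_T / T + v_T^2 < 0 up to a positive square. *)
Lemma convexity_bound (R : realType) (s q wA wB kA kB : R) :
  let W := wA + wB in let N := wA * kA + wB * kB in
  let Q := wA * kA ^+ 2 + wB * kB ^+ 2 in let D := 1 + q * W in
  0 < s -> 0 < q -> 0 < wA -> 0 < wB ->
  0 < 5 / 2 * s + Q - q * N ^+ 2 / D /\
  (s + N / D) ^+ 2 < (s + W / D) * (5 / 2 * s + Q - q * N ^+ 2 / D).
Proof.
move=> W N Q D s0 q0 wA0 wB0.
have D0 : 0 < D by rewrite addr_gt0// mulr_gt0// addr_gt0.
have DN := lt0r_neq0 D0.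
have [s0w q0w wA0w wB0w] := And4 (ltW s0) (ltW q0) (ltW wA0) (ltW wB0).
(* [W Q - N ^+ 2], the Cauchy-Schwarz defect. *)
pose d := wA * wB * (kA - kB) ^+ 2.
have d0 : 0 <= d by rewrite mulr_ge0 ?sqr_ge0// mulr_ge0.
(* Over the common denominator, Q D - q N^2 = Q + q (W Q - N^2). *)
have hE : 5 / 2 * s + Q - q * N ^+ 2 / D = (5 / 2 * s * D + (Q + q * d)) / D.
  by apply: (mulIf DN); rewrite divfK// mulrBl divfK// /d /Q /N /D /W; ring.
have Q0 : 0 <= Q + q * d.
  by do ![exact: sqr_ge0|apply: addr_ge0 => //|apply: mulr_ge0 => //].
split.
  by rewrite hE divr_gt0// ltr_wpDr// !mulr_gt0// invr_gt0.
rewrite hE -subr_gt0.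
(* A positivity certificate: Q - 2 N + 5/2 W is the sum of the w ((k - 1)^2 + 3/2), and (W Q - N^2)
   + q W d = D d. *)
have -> : (s + W / D) * ((5 / 2 * s * D + (Q + q * d)) / D) - (s + N / D) ^+ 2 =
    (3 / 2 * s ^+ 2 * D ^+ 2
     + (s * D * (wA * ((kA - 1) ^+ 2 + 3 / 2) + wB * ((kB - 1) ^+ 2 + 3 / 2)
                 + q * d) + D * d)) / D ^+ 2.
  apply: (@mulIf _ (D ^+ 2)); first by rewrite expf_neq0.
  rewrite divfK ?expf_neq0//.
  have -> : ((s + W / D) * ((5 / 2 * s * D + (Q + q * d)) / D)
      - (s + N / D) ^+ 2) * D ^+ 2 =
      (s * D + W) * (5 / 2 * s * D + (Q + q * d)) - (s * D + N) ^+ 2.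
    by field.
  by rewrite /d /Q /N /D /W; field.
rewrite divr_gt0// ?exprn_gt0// ltr_wpDr//; last first.
  by rewrite !mulr_gt0 ?invr_gt0 ?exprn_gt0.
have sq (w k : R) : 0 < w -> 0 <= w * ((k - 1) ^+ 2 + 3 / 2).
  by move=> w0; rewrite mulr_ge0 ?ltW// ltr_wpDl ?sqr_ge0// divr_gt0.
have D0w := ltW D0; have sA := sq wA kA wA0; have sB := sq wB kB wB0.
by do ![apply: addr_ge0 => //|apply: mulr_ge0 => //].
Qed.

(** Total differentiability at (p, T), stronger than the existence of both partial derivatives, so
    that the chain rule applies on states. *)
Definition partials (R : realType) (f : R -> R -> R) (p T fp fT : R) :=
  is_diff ((p, T) : R * R) (fun x : R * R => f x.1 x.2)
    (fun w => fp * w.1 + fT * w.2).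

(* The enthalpy derivative in [p] is the integrability condition for the
   entropy; the last inequality is the stability condition making the
   isentropic compressibility positive. *)
Lemma thermodynamic_derivatives (R : realType) (g : gas R)
    (aA aB : R -> R -> R) (p T : R) :
  0 < Rg g -> 0 < Mm g -> 0 < muA g -> 0 < muB g -> 0 < beta g < 1 ->
  ionization_degrees g aA aB -> 0 < p -> 0 < T ->
  let v := volume g aA aB in
  0 < v p T /\
  exists vp vT hT, [/\ partials v p T vp vT,
    partials (enthalpy g aA aB) p T (v p T - T * vT) hT,
    0 < hT & vp * (hT / T) + vT ^+ 2 < 0].
Proof.
move=> R0 M0 mA mB hb ion p0 T0 v.
have [dal dA dB] := ionization_increments mA mB hb ion p0 T0.
have [/andP[a0 a1] /andP[a0' a1'] _ _] := ion _ _ p0 T0.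
have /andP[b0 b1] := hb; have b1' : 0 < 1 - beta g by rewrite subr_gt0.
have al0 : 0 < alpha g aA aB p T by rewrite addr_gt0// mulr_gt0.
have TT := is_diff_snd ((p, T) : R * R).
have pp := is_diff_inv (lt0r_neq0 p0) (is_diff_fst ((p, T) : R * R)).
have TN := lt0r_neq0 T0; have pN := lt0r_neq0 p0; have MN := lt0r_neq0 M0.
move: dal dA dB.
set kA := 5 / 2 + TA g / T; set kB := 5 / 2 + TB g / T.
set wA := beta g * _; set wB := (1 - beta g) * _.
set al := alpha g aA aB p T in al0 *; set q := (al * (1 + al))^-1.
set D := 1 + q * (wA + wB) => dal dA dB.
have s0 : 0 < 1 + al by rewrite addr_gt0.
have q0 : 0 < q by rewrite invr_gt0 mulr_gt0.
have wA0 : 0 < wA by rewrite !mulr_gt0// subr_gt0.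
have wB0 : 0 < wB by rewrite !mulr_gt0// subr_gt0.
have D0 : 0 < D by rewrite addr_gt0// mulr_gt0// addr_gt0.
have DN := lt0r_neq0 D0.
have [h0 stab] := convexity_bound kA kB s0 q0 wA0 wB0.
rewrite -/D in h0 stab.
have vE : v p T = Rg g * T / (Mm g * p) * (1 + al) by [].
split; first by rewrite vE mulr_gt0// divr_gt0// mulr_gt0.
set W := wA + wB in stab h0 D0 DN *.
set N := wA * kA + wB * kB in stab h0 *.
set Q := wA * kA ^+ 2 + wB * kB ^+ 2 in stab h0 *.
(* The witnesses result from inserting d alpha = (- W dp / p + N dT / T) / D, and the matching
   increments of the two degrees, into v and h. *)
exists (- (Rg g * T / (Mm g * p ^+ 2) * (1 + al + W / D))),
  (Rg g / (Mm g * p) * (1 + al + N / D)),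
  (Rg g / Mm g * (5 / 2 * (1 + al) + Q - q * N ^+ 2 / D)).
split.
- have := is_diffM (is_diffZ (Rg g / Mm g) (is_diffM TT pp))
    (is_diffD (is_diff_cst (1 : R) _) dal).
  congr (is_diff_def _ _ _).
    by apply/funext => y; rewrite /v /volume !fctE /cst /GRing.scale /= invfM; ring.
  apply/funext => w; rewrite !fctE /cst /GRing.scale /= -/al -/W -/N add0r.
  by field; rewrite ?DN ?pN ?TN ?MN.
- have := is_diffD
    (is_diffZ (Rg g / Mm g)
      (is_diffM (is_diffZ (5 / 2) TT) (is_diffD (is_diff_cst (1 : R) _) dal)))
    (is_diffZ (Rg g / Mm g)
      (is_diffD (is_diffZ (beta g * TA g) dA)
                (is_diffZ ((1 - beta g) * TB g) dB))).
  congr (is_diff_def _ _ _).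
    apply/funext => y; rewrite /enthalpy !fctE /cst /GRing.scale /=; field.
    by rewrite MN.
  apply/funext => w; rewrite !fctE /cst /GRing.scale /= -/al -/W -/N add0r.
  rewrite vE.
  (* With T_i = T (k_i - 5/2), all sums over the species become combinations of [W], [N] and [Q]. *)
  have -> : TA g = T * (kA - 5 / 2) by rewrite /kA; field.
  have -> : TB g = T * (kB - 5 / 2) by rewrite /kB; field.
  set E := (- W * _ + _) / D.
  transitivity (Rg g / Mm g * (5 / 2 * T * E + 5 / 2 * (1 + al) * w.2
      + T * ((N - 5 / 2 * W) * (- (w.1 / p) - q * E) + (Q - 5 / 2 * N) * (w.2 / T)))).
    by rewrite /Q /N /W /wA /wB; ring.
  have DW : D = 1 + q * W by [].
  rewrite /E; rewrite DW in DN *; field.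
  by rewrite DN pN TN MN.
- by rewrite mulr_gt0// divr_gt0.
have -> : - (Rg g * T / (Mm g * p ^+ 2) * (1 + al + W / D)) *
   (Rg g / Mm g * (5 / 2 * (1 + al) + Q - q * N ^+ 2 / D) / T) +
   (Rg g / (Mm g * p) * (1 + al + N / D)) ^+ 2 =
   (Rg g / (Mm g * p)) ^+ 2 * ((1 + al + N / D) ^+ 2
     - (1 + al + W / D) * (5 / 2 * (1 + al) + Q - q * N ^+ 2 / D)).
  by field; rewrite ?DN ?pN ?TN ?MN.
rewrite pmulr_rlt0 ?subr_lt0//.
by rewrite exprn_gt0// divr_gt0// mulr_gt0.
Qed.

(** * Vector fields on the state space *)

Lemma col3P (R : realType) (u w : 'cV[R]_3) :
  u = w <-> [/\ prs u = prs w, vel u = vel w & tmp u = tmp w].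
Proof.
split=> [->//|[h0 h1 h2]]; apply/colP => -[[|[|[|//]]] i3].
- by rewrite [Ordinal _](_ : _ = 0)//; exact: val_inj.
- by rewrite [Ordinal _](_ : _ = 1)//; exact: val_inj.
- by rewrite [Ordinal _](_ : _ = 2)//; exact: val_inj.
Qed.

Lemma prs_col3 (R : realType) (a b c : R) : prs (col3 a b c) = a.
Proof. by rewrite /prs mxE. Qed.

Lemma vel_col3 (R : realType) (a b c : R) : vel (col3 a b c) = b.
Proof. by rewrite /vel mxE. Qed.

Lemma tmp_col3 (R : realType) (a b c : R) : tmp (col3 a b c) = c.
Proof. by rewrite /tmp mxE. Qed.

Definition col3E := (prs_col3, vel_col3, tmp_col3).

Lemma prsZ (R : realType) (k : R) (u : 'cV[R]_3) : prs (k *: u) = k * prs u.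
Proof. by rewrite /prs mxE. Qed.

Lemma velZ (R : realType) (k : R) (u : 'cV[R]_3) : vel (k *: u) = k * vel u.
Proof. by rewrite /vel mxE. Qed.

Lemma tmpZ (R : realType) (k : R) (u : 'cV[R]_3) : tmp (k *: u) = k * tmp u.
Proof. by rewrite /tmp mxE. Qed.

Lemma col3_neq0 (R : realType) (u : 'cV[R]_3) :
  u != 0 <-> ~ [/\ prs u = 0, vel u = 0 & tmp u = 0].
Proof.
split=> [/eqP u0 h|h].
  by apply: u0; apply/col3P; rewrite /prs /vel /tmp !mxE; exact: h.
apply/eqP => u0; apply: h; move/col3P : u0.
by rewrite /prs /vel /tmp !mxE.
Qed.

Lemma mulmx3E (R : realType) (A : 'M[R]_3) (r : 'cV[R]_3) (i : 'I_3) :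
  (A *m r) i 0 = A i 0 * prs r + A i 1 * vel r + A i 2 * tmp r.
Proof.
rewrite mxE !big_ord_recl big_ord0 addr0 addrA.
by congr (_ * _ + _ * _ + _ * _);
  [congr (A _ _)|congr (r _ _)|congr (A _ _)|congr (r _ _)];
  exact: val_inj.
Qed.

Lemma is_diff_coord (R : realType) (i : 'I_3) (U : 'cV[R]_3) :
  is_diff U (fun W : 'cV[R]_3 => W i 0) (fun w => w i 0).
Proof.
have lin : linear (fun W : 'cV[R]_3 => W i 0) by move=> k u w; rewrite !mxE.
pose linM := GRing.isLinear.Build _ _ _ _ _ lin.
pose f : {linear 'cV[R]_3 -> R} := HB.pack (fun W : 'cV[R]_3 => W i 0) linM.
have cf : continuous f by exact: coord_continuous.
split; first exact: (@linear_differentiable _ _ _ f).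
exact: (@diff_lin _ _ _ f).
Qed.

(** Expanding [r] in the basis [delta_mx] and using linearity of the differential; products with
    [grad] and [jac] reduce to this. *)
Lemma diff_sum_delta (R : realType) (f df : 'cV[R]_3 -> R) (U r : 'cV[R]_3) :
  is_diff U f df -> \sum_(j < 3) 'D_(delta_mx j 0) f U * r j 0 = df r.
Proof.
move=> [fU fE].
rewrite [in RHS](matrix_sum_delta r) -fE linear_sum; apply: eq_bigr => j _.
by rewrite big_ord1 linearZ deriveE//= mulrC.
Qed.

Lemma grad_mulmx (R : realType) (f df : 'cV[R]_3 -> R) (U r : 'cV[R]_3) :
  is_diff U f df -> grad f U *m r = (df r)%:M.
Proof.
move=> fU; apply/matrixP => i j; rewrite !ord1 !mxE eqxx mulr1n.
by rewrite -(diff_sum_delta _ fU); apply: eq_bigr => k _; rewrite mxE.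
Qed.

Lemma jac_mulmx (R : realType) (F : 'cV[R]_3 -> 'cV[R]_3) (df : 'cV[R]_3 -> R)
    (U r : 'cV[R]_3) (i : 'I_3) :
  is_diff U (fun W => F W i 0) df -> (jac F U *m r) i 0 = df r.
Proof.
move=> fU; rewrite mxE -(diff_sum_delta _ fU).
by apply: eq_bigr => k _; rewrite mxE.
Qed.

Lemma is_diff_at_state (R : realType) (f : R -> R -> R) (U : 'cV[R]_3)
    (fp fT : R) :
  partials f (prs U) (tmp U) fp fT ->
  is_diff U (at_state f) (fun w => fp * prs w + fT * tmp w).
Proof.
move=> hf.
exact: (is_diff_comp (is_diff_pair (is_diff_coord 0 U) (is_diff_coord 2 U)) hf).
Qed.

Lemma partialsE (R : realType) (f : R -> R -> R) (p T fp fT : R) :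
  partials f p T fp fT -> d_p f p T = fp /\ d_T f p T = fT.
Proof.
move=> hf.
have hp := is_diff_comp (is_diff_pair (is_diff_id p) (is_diff_cst T p)) hf.
have hT := is_diff_comp (is_diff_pair (is_diff_cst p T) (is_diff_id T)) hf.
split.
  rewrite /d_p derive1E'; last by case: hp.
  by case: hp => _ -> /=; rewrite mulr1 mulr0 addr0.
rewrite /d_T derive1E'; last by case: hT.
by case: hT => _ -> /=; rewrite mulr1 mulr0 add0r.
Qed.

(** Dividing dh - v dp by T yields Maxwell's relation S_p = - v_T and S_T = h_T / T; [eta_entropy]
    rescales both by M / R. *)
Lemma state_derivatives (R : realType) (g : gas R) (aA aB S : R -> R -> R)
    (p T : R) :
  0 < Rg g -> 0 < Mm g -> 0 < muA g -> 0 < muB g -> 0 < beta g < 1 ->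
  ionization_degrees g aA aB -> entropy g aA aB S -> 0 < p -> 0 < T ->
  let v := volume g aA aB in
  0 < v p T /\
  exists vp vT hT, [/\ partials v p T vp vT,
    partials (enthalpy g aA aB) p T (v p T - T * vT) hT,
    partials (eta_entropy g S) p T
      (Mm g / Rg g * - vT) (Mm g / Rg g * (hT / T)),
    0 < hT & vp * (hT / T) + vT ^+ 2 < 0].
Proof.
move=> R0 M0 mA mB hb ion hS p0 T0 v.
have [v0 [vp [vT [hT [dv dh hT0 j0]]]]] :=
  thermodynamic_derivatives R0 M0 mA mB hb ion p0 T0.
split=> //; exists vp, vT, hT; split=> //.
have [dS SE] := hS _ _ p0 T0.
have {}dS : is_diff ((p, T) : R * R) (fun x : R * R => S x.1 x.2)
    (fun w => - vT * w.1 + hT / T * w.2).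
  split=> //; apply/funext => w; have := SE w; case: dh => _ -> SEw.
  apply: (@mulfI _ T); first exact: lt0r_neq0.
  rewrite (_ : T * _ = (v p T - T * vT) * w.1 + hT * w.2 - v p T * w.1).
    by rewrite mulrDr mulrCA; field; exact: lt0r_neq0.
  by rewrite SEw addrK.
have := is_diffZ (Mm g / Rg g) dS.
congr (is_diff_def _ _ _); apply/funext => w.
by rewrite !fctE /GRing.scale /=; ring.
Qed.

(** * Characteristics *)

Section LagrangeSystem.
Variables (R : realType) (v e : R -> R -> R) (U : 'cV[R]_3).
Let J := at_state (jacobian_pT v e) U.
Let s := at_state (speed_sq v e) U.
Let ep := at_state (d_p e) U.
Let eT := at_state (d_T e) U.
Hypotheses (J0 : J != 0) (s0 : 0 < s).

Lemma lagrange_char_vectorE (lam : R) (r : 'cV[R]_3) :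
  char_vector 1%:M (lagrange_mx v e U) lam r <->
  r != 0 /\ [/\ s * vel r = lam * prs r, prs r = lam * vel r &
                ep / J * vel r = lam * tmp r].
Proof.
have sE : s = - (eT / J) by [].
rewrite /char_vector mul1mx; split=> -[r0 h]; split=> //.
  move/col3P : h; rewrite prsZ velZ tmpZ /prs /vel /tmp !mulmx3E !mxE /=.
  rewrite -/J -/ep -/eT -sE.
  by rewrite !mul0r !mul1r !(add0r, addr0).
apply/col3P; rewrite prsZ velZ tmpZ; move: h.
rewrite /prs /vel /tmp !mulmx3E !mxE /= -/J -/ep -/eT -sE.
by rewrite !mul0r !mul1r !(add0r, addr0).
Qed.

(** The sign [d], either 1 or -1, treats both acoustic families at once. The velocity component
    determines the other two, so the eigenspace is a line. *)
Lemma lagrange_sound_vectors (d : R) (r : 'cV[R]_3) : d * d = 1 ->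
  char_vector 1%:M (lagrange_mx v e U) (d * Num.sqrt s) r <->
  exists2 k, k != 0 & r = k *: col3 d (Num.sqrt s)^-1 (- (d * (ep / eT))).
Proof.
move=> dd; have sE : s = - (eT / J) by [].
have c0 : 0 < Num.sqrt s by rewrite sqrtr_gt0.
have cc : Num.sqrt s ^+ 2 = s by rewrite sqr_sqrtr// ltW.
move: (Num.sqrt s) c0 cc => c /lt0r_neq0 cN cc.
have dN : d != 0 by apply: contra_eq_neq dd => ->; rewrite mul0r eq_sym oner_neq0.
have eTN : eT != 0.
  by apply: contraTneq s0 => eT0; rewrite sE eT0 mul0r oppr0 ltxx.
have eTE : eT = - (J * c ^+ 2) by rewrite cc sE; field.
rewrite lagrange_char_vectorE; split.
  (* The factor is forced by the velocity component, which is 1 / c in the reference vector. *)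
  move=> [/col3_neq0 r0 [h1 h2 h3]]; exists (c * vel r).
    apply: contra_notN r0; rewrite mulf_eq0 (negbTE cN)/= => /eqP y0.
    split=> //; first by rewrite h2 y0 mulr0.
    apply: (@mulfI _ (d * c)); first by rewrite mulf_neq0.
    by rewrite -h3 y0 !mulr0.
  apply/col3P; rewrite prsZ velZ tmpZ !col3E; split.
  - by rewrite h2; ring.
  - by field.
  apply: (@mulfI _ (d * c)); first by rewrite mulf_neq0.
  rewrite -h3 eTE.
  transitivity (d * d * (ep / J * vel r)); first by rewrite dd mul1r.
  by field; rewrite J0 cN.
move=> [k k0 ->]; split.
  apply/col3_neq0; rewrite prsZ velZ tmpZ !col3E => -[/eqP h _ _].
  by move: h; rewrite mulf_eq0 (negbTE k0) (negbTE dN).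
rewrite prsZ velZ tmpZ !col3E; split.
- transitivity (d * d * (k * c)); last by ring.
  by rewrite dd -cc; field.
- by field.
rewrite eTE; transitivity (d * d * (ep / J * (k / c))); first by rewrite dd mul1r.
by field; rewrite J0 cN.
Qed.

Lemma lagrange_contact_vectors (r : 'cV[R]_3) :
  char_vector 1%:M (lagrange_mx v e U) 0 r <->
  exists2 k, k != 0 & r = k *: col3 0 0 1.
Proof.
rewrite lagrange_char_vectorE; split.
  move=> [/col3_neq0 r0 [h1 h2 h3]].
  have p0 : prs r = 0 by rewrite h2 mul0r.
  have y0 : vel r = 0.
    by apply: (@mulfI _ s); rewrite ?lt0r_neq0// h1 mul0r mulr0.
  exists (tmp r); first by apply: contra_notN r0 => /eqP t0.
  by apply/col3P; rewrite prsZ velZ tmpZ !col3E !mulr0 mulr1.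
move=> [k k0 ->]; rewrite prsZ velZ tmpZ !col3E !mulr0 !mul0r; split=> //.
apply/col3_neq0; rewrite prsZ velZ tmpZ !col3E mulr1 => -[_ _ /eqP].
exact/negP.
Qed.

(** The first two rows give lam^2 y = s y for the velocity component y; if lam is nonzero, y = 0
    would make the whole vector vanish. *)
Lemma lagrange_char_speeds (lam : R) :
  char_speed 1%:M (lagrange_mx v e U) lam <->
  [\/ lam = Num.sqrt s, lam = - Num.sqrt s | lam = 0].
Proof.
split.
  move=> [r /lagrange_char_vectorE [/col3_neq0 r0 [h1 h2 h3]]].
  have [->|lam0] := eqVneq lam 0; first by constructor 3.
  have y0 : vel r != 0.
    apply: contra_notN r0 => /eqP y0; split=> //; first by rewrite h2 y0 mulr0.
    by apply: (mulfI lam0); rewrite -h3 y0 !mulr0.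
  have : lam ^+ 2 == Num.sqrt s ^+ 2.
    rewrite sqr_sqrtr ?ltW//; apply/eqP; apply: (mulIf y0).
    by rewrite h1 h2; ring.
  by rewrite eqf_sqr => /orP[] /eqP ->; [constructor 1|constructor 2].
case=> ->.
- rewrite -[Num.sqrt s]mul1r; exists (1 *: col3 1 (Num.sqrt s)^-1 (- (1 * (ep / eT)))).
  apply/lagrange_sound_vectors; first by rewrite mulr1.
  by exists 1 => //; exact: oner_neq0.
- rewrite -[Num.sqrt s]mul1r -mulNr.
  exists (1 *: col3 (- 1) (Num.sqrt s)^-1 (- (- 1 * (ep / eT)))).
  apply/lagrange_sound_vectors; first by rewrite mulrNN mulr1.
  by exists 1 => //; exact: oner_neq0.
- exists (1 *: col3 0 0 1); apply/lagrange_contact_vectors.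
  by exists 1 => //; exact: oner_neq0.
Qed.

End LagrangeSystem.

(** * Eigenvalues of the Eulerian system in the same state variables *)

Section EulerSystem.
Variables (R : realType) (g : gas R) (aA aB : R -> R -> R) (U : 'cV[R]_3).
Let v := volume g aA aB.
Let p := prs U.
Let u := vel U.
Let T := tmp U.
Let V := v p T.
Variables (vp vT hT : R).
Hypotheses (T0 : 0 < T) (V0 : 0 < V) (hT0 : 0 < hT).
Hypothesis dv : partials v p T vp vT.
Hypothesis dh : partials (enthalpy g aA aB) p T (V - T * vT) hT.

Let G := jac (euler_cons g aA aB) U.
Let F := jac (euler_flux g aA aB) U.
Let drho (w : 'cV[R]_3) := - (V^-1 * V^-1 * (vp * prs w + vT * tmp w)).
(** In d(h - p v) the term V dp of dh cancels that of d(p v); what remains of dh, hT dT - T vT dp,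
    is T dS. *)
Let denergy (w : 'cV[R]_3) :=
  u * vel w + (hT * tmp w - T * vT * prs w - p * (vp * prs w + vT * tmp w)).
Let E := total_energy g aA aB U.

Lemma is_diff_density : is_diff U (at_state (density g aA aB)) drho.
Proof.
exact: (@is_diff_inv _ _ (at_state v) _ _ (lt0r_neq0 V0) (is_diff_at_state dv)).
Qed.

Lemma is_diff_total_energy : is_diff U (total_energy g aA aB) denergy.
Proof.
have dp : is_diff U (@prs R) (@prs R) := is_diff_coord 0 U.
have du : is_diff U (@vel R) (@vel R) := is_diff_coord 1 U.
have := is_diffD (is_diffZ (2^-1) (is_diffM du du))
  (is_diffB (is_diff_at_state dh) (is_diffM dp (is_diff_at_state dv))).
congr (is_diff_def _ _ _); apply/funext => w.
  by rewrite /total_energy !fctE /GRing.scale /at_state /internal_energy /v /=; ring.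
rewrite !fctE /GRing.scale /= /denergy -/u -/p.
rewrite (_ : at_state v U = V)//.
by field.
Qed.

Lemma euler_cons_jac (w : 'cV[R]_3) :
  G *m w = col3 (drho w) (u * drho w + V^-1 * vel w)
                (E * drho w + V^-1 * denergy w).
Proof.
have du : is_diff U (@vel R) (@vel R) := is_diff_coord 1 U.
have drh := is_diff_density; have dE := is_diff_total_energy.
apply/col3P; rewrite !col3E; split.
- rewrite /prs; apply: jac_mulmx.
  by move: drh; congr (is_diff_def _ _ _); apply/funext => W; rewrite mxE.
- rewrite /vel; apply: (@jac_mulmx _ _ (fun w => u * drho w + V^-1 * vel w)).
  have := is_diffM drh du.
  congr (is_diff_def _ _ _); apply/funext => W; first by rewrite mxE.
  by rewrite !fctE /GRing.scale /= addrC.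
- rewrite /tmp; apply: (@jac_mulmx _ _ (fun w => E * drho w + V^-1 * denergy w)).
  have := is_diffM drh dE.
  congr (is_diff_def _ _ _); apply/funext => W; first by rewrite mxE.
  by rewrite !fctE /GRing.scale /= addrC.
Qed.

Lemma euler_flux_jac (w : 'cV[R]_3) :
  F *m w = col3 (u * drho w + V^-1 * vel w)
                (u ^+ 2 * drho w + 2 * V^-1 * u * vel w + prs w)
                (u * (E * drho w + V^-1 * denergy w) + V^-1 * E * vel w
                 + p * vel w + u * prs w).
Proof.
have dp : is_diff U (@prs R) (@prs R) := is_diff_coord 0 U.
have du : is_diff U (@vel R) (@vel R) := is_diff_coord 1 U.
have drh := is_diff_density; have dE := is_diff_total_energy.
apply/col3P; rewrite !col3E; split.
- rewrite /prs; apply: (@jac_mulmx _ _ (fun w => u * drho w + V^-1 * vel w)).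
  have := is_diffM drh du.
  congr (is_diff_def _ _ _); apply/funext => W; first by rewrite mxE.
  by rewrite !fctE /GRing.scale /= addrC.
- rewrite /vel; apply: (@jac_mulmx _ _ (fun w =>
    u ^+ 2 * drho w + 2 * V^-1 * u * vel w + prs w)).
  have := is_diffD (is_diffM drh (is_diffM du du)) dp.
  congr (is_diff_def _ _ _); apply/funext => W; first by rewrite mxE.
  rewrite !fctE /GRing.scale /= -/u (_ : at_state _ U = V^-1)//; ring.
- rewrite /tmp; apply: (@jac_mulmx _ _ (fun w =>
    u * (E * drho w + V^-1 * denergy w) + V^-1 * E * vel w + p * vel w
    + u * prs w)).
  have := is_diffD (is_diffM (is_diffM drh dE) du) (is_diffM dp du).
  congr (is_diff_def _ _ _); apply/funext => W; first by rewrite mxE.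
  rewrite !fctE /GRing.scale /= -/u -/p -/E (_ : at_state _ U = V^-1)//; ring.
Qed.

(* In the frame moving with the fluid the mass, momentum and energy equations
   become [V y = - m dv], [V x = m y] and [m T dS = 0]. *)
Lemma euler_char_vectorE (m : R) (r : 'cV[R]_3) :
  char_vector G F (u + m) r <->
  r != 0 /\ [/\ V * vel r = - m * (vp * prs r + vT * tmp r),
                V * prs r = m * vel r &
                m * (hT * tmp r - T * vT * prs r) = 0].
Proof.
have VN := lt0r_neq0 V0.
rewrite /char_vector euler_cons_jac euler_flux_jac; split=> -[r0 h]; split=> //.
  move/col3P : h; rewrite prsZ velZ tmpZ !col3E => -[h1 h2 h3].
  have k1 : V^-1 * vel r = m * drho r.
    by apply: (addrI (u * drho r)); rewrite h1; ring.
  have k2 : prs r = m * (V^-1 * vel r).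
    apply: (addrI (u ^+ 2 * drho r + 2 * V^-1 * u * vel r)); rewrite h2.
    transitivity (u ^+ 2 * drho r + u * (m * drho r) + u * (V^-1 * vel r)
      + m * (V^-1 * vel r)); first by ring.
    by rewrite -k1; ring.
  split.
  - apply: (@mulfI _ (V^-1 * V^-1)); first by rewrite mulf_neq0 ?invr_neq0.
    transitivity (V^-1 * vel r); first by field.
    by rewrite k1 /drho; ring.
  - by rewrite {1}k2; field.
  have k3 : vel r = - m * (V^-1 * (vp * prs r + vT * tmp r)).
    by rewrite -[LHS](mulVKf VN) k1 /drho; field.
  apply: (@mulfI _ V^-1); first by rewrite invr_neq0.
  (* Combining the energy equation with E times mass, u times momentum and p times the volume
     equation leaves only the heat term m T dS. *)
  rewrite mulr0; transitivity
    ((u + m) * (E * drho r + V^-1 * denergy r)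
     - (u * (E * drho r + V^-1 * denergy r) + V^-1 * E * vel r
        + p * vel r + u * prs r)
     + E * (V^-1 * vel r - m * drho r) + u * (prs r - m * (V^-1 * vel r))
     + p * (vel r - - m * (V^-1 * (vp * prs r + vT * tmp r)))).
    by rewrite /denergy; ring.
  by rewrite h3 -k1 -k2 -k3 !subrr !mulr0 !addr0.
case: h => k1 k2 k3.
have K1 : V^-1 * vel r - m * drho r = 0.
  rewrite /drho; transitivity (V^-1 * V^-1 * (V * vel r
    - - m * (vp * prs r + vT * tmp r))); first by field.
  by rewrite k1 subrr mulr0.
have K2 : prs r - m * (V^-1 * vel r) = 0.
  transitivity (V^-1 * (V * prs r - m * vel r)); first by field.
  by rewrite k2 subrr mulr0.
have K3 : vel r - - m * (V^-1 * (vp * prs r + vT * tmp r)) = 0.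
  transitivity (V^-1 * (V * vel r - - m * (vp * prs r + vT * tmp r))).
    by field.
  by rewrite k1 subrr mulr0.
apply/col3P; rewrite prsZ velZ tmpZ !col3E; split; apply: subr0_eq.
- by transitivity (V^-1 * vel r - m * drho r) => //; ring.
- transitivity (u * (V^-1 * vel r - m * drho r) + (prs r - m * (V^-1 * vel r))).
    by ring.
  by rewrite K1 K2 mulr0 addr0.
transitivity
  (- (V^-1 * (m * (hT * tmp r - T * vT * prs r)))
   + E * (V^-1 * vel r - m * drho r) + u * (prs r - m * (V^-1 * vel r))
   + p * (vel r - - m * (V^-1 * (vp * prs r + vT * tmp r)))).
  by rewrite /denergy; ring.
by rewrite k3 K1 K2 K3 !mulr0 oppr0 !addr0.
Qed.

(** [c] is either root of the squared Lagrangian speed. For nonzero m the direction is isentropic,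
    and eliminating dT and the velocity leaves m^2 = V^2 c^2. *)
Lemma euler_char_speeds (c lam : R) :
  c ^+ 2 = - (hT / T / (vp * (hT / T) + vT ^+ 2)) ->
  vp * (hT / T) + vT ^+ 2 < 0 ->
  char_speed G F lam <->
  [\/ lam = u + V * c, lam = u - V * c | lam = u].
Proof.
move=> cc j0.
have VN := lt0r_neq0 V0; have TN := lt0r_neq0 T0; have hTN := lt0r_neq0 hT0.
set j := _ + _ in cc j0; have jN : j != 0 by rewrite lt_eqF.
have key (m : R) : char_speed G F (u + m) <-> [\/ m = V * c, m = - (V * c) | m = 0].
  split.
    move=> [r /euler_char_vectorE [/col3_neq0 r0 [h1 h2 h3]]].
    have [->|m0] := eqVneq m 0; first by constructor 3.
    have hz : hT * tmp r = T * vT * prs r.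
      by apply/eqP; rewrite -subr_eq0; apply/eqP; apply: (mulfI m0); rewrite mulr0.
    have x0 : prs r != 0.
      apply: contra_notN r0 => /eqP x0; split=> //.
        by apply: (mulfI m0); rewrite -h2 x0 !mulr0.
      by apply: (mulfI hTN); rewrite hz x0 !mulr0.
    have : m ^+ 2 == (V * c) ^+ 2.
      rewrite (exprMn 2 V c) cc; apply/eqP.
      apply: (@mulIf _ (j * T * prs r)); first by rewrite !mulf_neq0.
      transitivity (m * (vp * prs r * hT + vT * (hT * tmp r)) * m).
        by rewrite hz /j; field.
      transitivity (- (hT * (- m * (vp * prs r + vT * tmp r)) * m)).
        by ring.
      rewrite -h1; transitivity (- (hT * V * (m * vel r))); first by ring.
      by rewrite -h2; field; rewrite TN jN.
    by rewrite eqf_sqr => /orP[] /eqP ->; [constructor 1|constructor 2].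
  have sound (m' : R) : m' ^+ 2 = (V * c) ^+ 2 -> char_speed G F (u + m').
    (* The isentropic direction scaled so that dp = h_T and dT = T v_T; the velocity is read off
       from V dp = m du. *)
    move=> mm; exists (col3 hT (V * hT / m') (T * vT)).
    have m0 : m' != 0.
      rewrite -sqrf_eq0 mm (exprMn 2 V c) cc mulf_neq0 ?expf_neq0//.
      by rewrite oppr_eq0 !mulf_neq0 ?invr_neq0.
    apply/euler_char_vectorE; split.
      by apply/col3_neq0; rewrite !col3E => -[/eqP]; rewrite (negbTE hTN).
    rewrite !col3E; split.
    - apply: (mulfI m0); transitivity (V ^+ 2 * hT); first by field.
      transitivity (- (m' ^+ 2) * (T * j)); last by rewrite /j; field.
      by rewrite mm (exprMn 2 V c) cc; field; rewrite jN.
    - by field.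
    - by ring.
  case=> ->; [exact: sound|by apply: sound; rewrite sqrrN|].
  exists (col3 0 0 1); apply/euler_char_vectorE; split.
    by apply/col3_neq0; rewrite !col3E => -[_ _ /eqP]; rewrite oner_eq0.
  by rewrite !col3E !mulr0 !mul0r oppr0 mul0r.
have -> : lam = u + (lam - u) by rewrite addrC subrK.
rewrite key; split=> -[] h.
- by constructor 1; rewrite h.
- by constructor 2; rewrite h.
- by constructor 3; rewrite h addr0.
- by constructor 1; apply: (addrI u).
- by constructor 2; apply: (addrI u).
- by constructor 3; apply: (addrI u); rewrite h addr0.
Qed.

End EulerSystem.

Theorem lemma7 (R : realType) (g : gas R) (aA aB S : R -> R -> R)
  (hR : 0 < Rg g) (hM : 0 < Mm g) (hmuA : 0 < muA g) (hmuB : 0 < muB g)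
  (hbeta : 0 < beta g < 1)
  (hTA : 0 < TA g) (hTAB : TA g < TB g) (hTB : TB g <= 2 * TA g)
  (hion : ionization_degrees g aA aB)
  (hS : entropy g aA aB S) :
  let v := volume g aA aB in
  let e := eta_entropy g S in
  let A := lagrange_mx v e in
  [/\ (* the expressions below are well defined *)
      (forall U, states U ->
         at_state (jacobian_pT v e) U != 0 /\ 0 < at_state (speed_sq v e) U),
      (* characteristic speeds and characteristic vector fields *)
      (forall U, states U ->
         [/\ (forall lam, char_speed 1%:M (A U) lam <->
                [\/ lam = lam_plus v e U, lam = lam_minus v e U
                  | lam = lam_zero U]),
             (forall r, char_vector 1%:M (A U) (lam_plus v e U) r <->
                exists2 k, k != 0 & r = k *: r_plus v e U),
             (forall r, char_vector 1%:M (A U) (lam_minus v e U) r <->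
                exists2 k, k != 0 & r = k *: r_minus v e U) &
             (forall r, char_vector 1%:M (A U) (lam_zero U) r <->
                exists2 k, k != 0 & r = k *: r_zero U)]),
      (* lam_zero is linearly degenerate, with Riemann invariants u and p *)
      [/\ linearly_degenerate (@states R) (@r_zero R) (@lam_zero R),
          riemann_invariant (@states R) (@r_zero R) (@vel R),
          riemann_invariant (@states R) (@r_zero R) (@prs R) &
          (forall U, states U ->
             row_free (col_mx (grad (@vel R) U) (grad (@prs R) U)))],
      (* eta is a Riemann invariant for lam_plus and lam_minus *)
      riemann_invariant (@states R) (r_plus v e) (at_state e) /\
      riemann_invariant (@states R) (r_minus v e) (at_state e) &
      (* characteristic speeds of the Eulerian system *)
      (forall U, states U -> forall lam,
         char_speed (jac (euler_cons g aA aB) U) (jac (euler_flux g aA aB) U) lam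
         <-> [\/ lam = vel U + (at_state (density g aA aB) U)^-1 * lam_plus v e U,
                 lam = vel U + (at_state (density g aA aB) U)^-1 * lam_minus v e U
               | lam = vel U])].
Proof.
move=> v e A.
have k0 : 0 < Mm g / Rg g by rewrite divr_gt0.
have sd U (hU : states U) :=
  state_derivatives hR hM hmuA hmuB hbeta hion hS hU.1 hU.2.
(* The factor M / R of eta enters numerator and Jacobian alike and cancels in the squared speed. *)
have speedE (U : 'cV[R]_3) vp vT hT : 0 < tmp U ->
    partials v (prs U) (tmp U) vp vT ->
    partials e (prs U) (tmp U) (Mm g / Rg g * - vT)
      (Mm g / Rg g * (hT / tmp U)) ->
    at_state (jacobian_pT v e) U =
      Mm g / Rg g * (vp * (hT / tmp U) + vT ^+ 2) /\
    at_state (speed_sq v e) U =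
      - (hT / tmp U / (vp * (hT / tmp U) + vT ^+ 2)).
  move=> T0 /partialsE[vpE vTE] /partialsE[epE eTE].
  have JE : at_state (jacobian_pT v e) U =
      Mm g / Rg g * (vp * (hT / tmp U) + vT ^+ 2).
    by rewrite /at_state /jacobian_pT vpE vTE epE eTE; ring.
  split=> //; rewrite {1}/at_state /speed_sq -/(at_state (jacobian_pT v e) U).
  by rewrite JE eTE -mulf_div divff ?lt0r_neq0// mul1r.
have pos U : states U ->
    at_state (jacobian_pT v e) U != 0 /\ 0 < at_state (speed_sq v e) U.
  move=> hU; have [_ [vp [vT [hT [dv dh de hT0 j0]]]]] := sd U hU.
  have [-> ->] := speedE _ _ _ _ hU.2 dv de; split.
    by rewrite mulf_neq0 ?(lt0r_neq0 k0)// lt_eqF.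
  by rewrite oppr_gt0 pmulr_rlt0 ?invr_lt0// divr_gt0// hU.2.
have d_vel U : is_diff U (@vel R) (@vel R) := is_diff_coord 1 U.
have d_prs U : is_diff U (@prs R) (@prs R) := is_diff_coord 0 U.
have scal0 : (0 : R)%:M = 0 :> 'M[R]_1 by rewrite raddf0.
have r_plusE U : r_plus v e U = col3 1 (Num.sqrt (at_state (speed_sq v e) U))^-1
    (- (1 * (at_state (d_p e) U / at_state (d_T e) U))) by rewrite mul1r.
have r_minusE U : r_minus v e U =
    col3 (- 1) (Num.sqrt (at_state (speed_sq v e) U))^-1
    (- (- 1 * (at_state (d_p e) U / at_state (d_T e) U))).
  by rewrite mulN1r opprK.
have lam_plusE U : lam_plus v e U = 1 * Num.sqrt (at_state (speed_sq v e) U).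
  by rewrite mul1r.
have lam_minusE U : lam_minus v e U = - 1 * Num.sqrt (at_state (speed_sq v e) U).
  by rewrite mulN1r.
(* Pressure and temperature contribute d eta_p and - d eta_p, whatever [d] is; the cancellation of
   eta_T rests on h_T > 0. *)
have inv_e (d : R) : riemann_invariant (@states R)
    (fun U => col3 d (Num.sqrt (at_state (speed_sq v e) U))^-1
       (- (d * (at_state (d_p e) U / at_state (d_T e) U)))) (at_state e).
  move=> U hU; have [_ [vp [vT [hT [_ _ de hT0 _]]]]] := sd U hU.
  have dU := is_diff_at_state de; split; first by case: dU.
  rewrite (grad_mulmx _ dU) -scal0; congr (_%:M); rewrite !col3E.
  have [epE eTE] := partialsE de; rewrite /at_state epE eTE.
  have T0 := lt0r_neq0 hU.2.
  by field; rewrite T0 !lt0r_neq0.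
split=> //.
- move=> U hU; have [J0 s0] := pos U hU; split.
  + exact: lagrange_char_speeds.
  + by move=> r; rewrite lam_plusE r_plusE; apply: lagrange_sound_vectors; rewrite ?mulr1.
  + move=> r; rewrite lam_minusE r_minusE; apply: lagrange_sound_vectors => //.
    by rewrite mulrNN mulr1.
  + exact: lagrange_contact_vectors.
- split.
  + move=> U _; have d0 := is_diff_cst (0 : R) U; split; first by case: d0.
    by rewrite (grad_mulmx _ d0) -scal0.
  + move=> U _; split; first by case: (d_vel U).
    by rewrite (grad_mulmx _ (d_vel U)) -scal0 col3E.
  + move=> U _; split; first by case: (d_prs U).
    by rewrite (grad_mulmx _ (d_prs U)) -scal0 col3E.
  move=> U _; apply/inj_row_free => w; rewrite -[w]hsubmxK mul_row_col => w0.
  have w0r r : lsubmx w *m (vel r)%:M + rsubmx w *m (prs r)%:M = 0.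
    rewrite -(grad_mulmx r (d_vel U)) -(grad_mulmx r (d_prs U)) !mulmxA -mulmxDl.
    by rewrite w0 mul0mx.
  (* Testing a vanishing combination of the two gradients on the u- and p-directions isolates each
     coefficient. *)
  have := w0r (col3 0 1 0); have := w0r (col3 1 0 0).
  by rewrite !col3E !scal0 !mulmx0 !mulmx1 add0r addr0 => -> ->; rewrite row_mx0.
- split.
  + by rewrite (funext r_plusE); exact: inv_e.
  + by rewrite (funext r_minusE); exact: inv_e.
move=> U hU lam; have [v0 [vp [vT [hT [dv dh de hT0 j0]]]]] := sd U hU.
have [_ sE] := speedE _ _ _ _ hU.2 dv de.
have [_ s0] := pos U hU.
rewrite /density invrK -/v /lam_minus mulrN /lam_plus.
apply: (euler_char_speeds hU.2 v0 hT0 dv dh) => //.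
by rewrite sqr_sqrtr ?ltW.
Qed.
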